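(* Let $n \ge 1$, and let $D_1$ and $D_2$ be decks that are permutations of the multiset $\{1^n, 2^n\}$. If $D_1$ is $R$-related to $D_2$, then for every integer $a \ge 1$ the transition probability from the deck $1^n, 2^n$ to $D_1$ under an $a$-shuffle is equal to the transition probability from $1^n, 2^n$ to $D_2$ under an $a$-shuffle.
   Context: A deck of $N$ cards is a finite sequence of $N$ labels, listed from top to bottom; labels may repeat, and cards with the same label are indistinguishable. The deck $1^n,2^n$ consists of $n$ cards labeled $1$ followed by $n$ cards labeled $2$. A shuffle of $N$ cards is a permutation $\pi \in S_N$; $\pi(i)=j$ means that the card in position $i$ is sent to position $j$, so $\pi$ applied to the deck $c_1,\ldots,c_N$ results in the deck $c_{\pi^{-1}(1)},\ldots,c_{\pi^{-1}(N)}$. The $a$-shuffle is the following probability distribution on $S_N$. Choose a sequence $(a_1,\ldots,a_N)$ uniformly from the $a^N$ integer sequences with $0 \le a_i < a$. Sort it stably: let $i_1,\ldots,i_N$ be the unique permutation of $\{1,\ldots,N\}$ with $a_{i_1}\le a_{i_2}\le\cdots\le a_{i_N}$ and $i_j<i_{j+1}$ whenever $a_{i_j}=a_{i_{j+1}}$. The resulting shuffle is $\pi$ with $\pi(k)=i_k$ for $1\le k\le N$. The transition probability from a deck $D$ to a deck $D'$ under an $a$-shuffle is the probability that an $a$-shuffle applied to $D$ results in $D'$. The relation $R$. For a finite sequence $\alpha$ of $1$'s and $2$'s, $|\alpha|$ denotes its length, and $\alpha^*$ denotes the sequence obtained by reversing the order of $\alpha$ and then replacing each $1$ by $2$ and each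 $2$ by $1$. On the set of the $\binom{2n}{n}$ decks that are permutations of $\{1^n,2^n\}$, relate $\alpha\beta\gamma$ (concatenation) to $\alpha\beta^*\gamma$ whenever $|\alpha|=|\gamma|$ and the number of $1$'s in $\beta$ equals the number of $2$'s in $\beta$. $R$ is the equivalence relation obtained as the reflexive, transitive closure of this (symmetric) relation. *)

(* Defs.v *)
From Stdlib Require Import Relation_Operators.
From mathcomp Require Import all_boot all_order all_fingroup all_algebra.
From mathcomp Require Import zify.

Set Implicit Arguments.
Unset Strict Implicit.
Unset Printing Implicit Defensive.

Import GRing.Theory.

Local Open Scope nat_scope.

(* Positions 1, ..., N of a deck are represented by 0, ..., N - 1 : 'I_N, the
   top of the deck being position 0. *)

(* The card in position i is moved to position p i. *)
Definition apply_shuffle (T : Type) (N : nat) (p : 'S_N) (D : N.-tuple T) :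
    N.-tuple T :=
  [tuple tnth D ((p^-1)%g j) | j < N].

(* p lists the positions i_1, ..., i_N of the stable sort of w: p k is i_k. *)
Definition stably_sorts (a N : nat) (w : {ffun 'I_N -> 'I_a}) (p : 'S_N) :
    bool :=
  [forall j : 'I_N, forall k : 'I_N, (k == j.+1 :> nat) ==>
     ((w (p j) <= w (p k)) && ((w (p j) == w (p k)) ==> (p j < p k)))].

Lemma stably_sorts_unique (a N : nat) (w : {ffun 'I_N -> 'I_a}) :
  exists! p : 'S_N, stably_sorts w p.
Proof.
pose r (i j : 'I_N) := (w i < w j) || (w i == w j) && (i < j).
have r_tr : transitive r.
  move=> y x z; rewrite /r -!val_eqE /=; lia.
have r_irr : irreflexive r by move=> x; rewrite /r !ltnn andbF.
pose r' (i j : 'I_N) := (i == j) || r i j.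
have r'_total : total r' by move=> x y; rewrite /r' /r -!val_eqE /=; lia.
have sortsE p : stably_sorts w p = sorted r [seq p i | i <- enum 'I_N].
  have sz : size [seq p i | i <- enum 'I_N] = N.
    by rewrite size_map size_enum_ord.
  have rE i j : r i j = (w i <= w j) && ((w i == w j) ==> (i < j)).
    by rewrite /r -val_eqE /=; lia.
  have nthE x0 (k : 'I_N) : nth x0 [seq p i | i <- enum 'I_N] k = p k.
    by rewrite (nth_map k) ?size_enum_ord // nth_ord_enum.
  apply/idP/idP => [/forallP h | h].
    case E: [seq p i | i <- enum 'I_N] => [//|x0 l]; rewrite -E.
    apply/(sortedP x0) => i; rewrite sz => lt_i.
    rewrite (nthE x0 (Ordinal (ltnW lt_i))) (nthE x0 (Ordinal lt_i)) rE.
    have /forallP/(_ (Ordinal lt_i))/implyP := h (Ordinal (ltnW lt_i)).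
    by apply.
  apply/forallP => j; apply/forallP => k; apply/implyP => /eqP kE.
  have /(sortedP (p j))/(_ (val j)) := h.
  by rewrite sz -rE -kE ltn_ord !nthE; apply.
pose s := sort r' (enum 'I_N).
have ss : size s = N by rewrite size_sort size_enum_ord.
have us : uniq s by rewrite sort_uniq enum_uniq.
have rs : sorted r s.
  have := sort_sorted r'_total (enum 'I_N); rewrite -/s.
  case: {ss} s us => // x s; elim: s x => //= y s IH x.
  rewrite inE negb_or -!andbA => /and4P[nxy _ ny us] /andP[].
  by rewrite /r' (negPf nxy) /= => -> pys; apply: IH; rewrite //= ny.
have f_inj : injective (fun k : 'I_N => nth k s k).
  move=> i j; rewrite (set_nth_default i j) ?ss // => /eqP.
  by rewrite nth_uniq ?ss // => /eqP/val_inj.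
exists (perm f_inj); split.
  rewrite sortsE; case E: [seq perm f_inj i | i <- enum 'I_N] => [//|x0 l].
  rewrite -E (_ : map _ _ = s) //; apply: (@eq_from_nth _ x0).
    by rewrite size_map size_enum_ord.
  rewrite size_map size_enum_ord => i lt_i.
  rewrite (nth_map (Ordinal lt_i)) ?size_enum_ord //.
  rewrite (nth_ord_enum _ (Ordinal lt_i)) permE.
  by apply: set_nth_default; rewrite ss.
move=> q; rewrite sortsE => qs; apply/permP => i.
have sE : s = [seq q i | i <- enum 'I_N].
  apply: (irr_sorted_eq r_tr r_irr) => // x.
  rewrite mem_sort mem_enum; apply/esym/mapP; exists ((q^-1)%g x).
    by rewrite mem_enum.
  by rewrite permKV.
by rewrite permE sE (nth_map i) ?size_enum_ord // nth_ord_enum.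
Qed.

Definition ashuffle_prob (a N : nat) (p : 'S_N) : rat :=
  (#|[set w : {ffun 'I_N -> 'I_a} | stably_sorts w p]|%:R / (a ^ N)%:R)%R.

Definition transition_prob (T : eqType) (a N : nat) (D D' : N.-tuple T) : rat :=
  (\sum_(p : 'S_N | apply_shuffle p D == D') ashuffle_prob a p)%R.

(* 1^n, 2^n *)
Definition sorted_deck (n : nat) : (n + n).-tuple nat :=
  [tuple of nseq n 1 ++ nseq n 2].

Definition deck12 (n : nat) : Type :=
  {D : (n + n).-tuple nat | perm_eq D (sorted_deck n)}.

Definition swap12 (x : nat) : nat :=
  if x == 1 then 2 else if x == 2 then 1 else x.

(* The sequence written alpha^* *)
Definition reverse_swap (s : seq nat) : seq nat := [seq swap12 x | x <- rev s].

Definition flip_step (n : nat) (D D' : deck12 n) : Prop :=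
  exists alpha beta gamma : seq nat,
    [/\ sval D = alpha ++ beta ++ gamma :> seq nat,
        sval D' = alpha ++ reverse_swap beta ++ gamma :> seq nat,
        size alpha = size gamma
      & count_mem 1 beta = count_mem 2 beta].

Definition R_related (n : nat) : deck12 n -> deck12 n -> Prop :=
  clos_refl_trans (deck12 n) (@flip_step n).

(* Main.v *)
(** Reading the digits at the positions of the resulting deck D, the transition
    probability is a^(-2n) times the number of w such that (w_i, i) < (w_j, j)
    lexicographically whenever D_i = 1 and D_j = 2. Sorting these w by the
    first pair (t, q) carried by a 2 gives
      sum over the 2's of D of F(x, y),
      F(x, y) = sum_t (t+1)^x t^(n-x) (a-t-1)^y (a-t)^(n-1-y),
    where x and y count the 1's and 2's above that 2; D is thus seen as a
    lattice path with step weights F. Put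
      P(x, y) = sum_t (t+1)^x t^(n-x) (a-t-1)^y (a-t)^(n-y),
      G(x, y) = P(x+1, y) - P(x, y), and note F(x, y) = P(x, y) - P(x, y+1).
    The substitution t -> a-1-t gives P(x, y) = P(n-y, n-x) and
    F(x, y) = G(n-1-y, n-x). When beta is a balanced central segment, beta^* is
    its reflection under (x, y) -> (n-y, n-x), so the F-sum over the 2's of beta
    is the G-sum over the 1's of beta^*. By telescoping, the latter differs from
    the F-sum over the 2's of beta^* by the difference of P at the two endpoints
    of the segment, which vanishes since the reflection exchanges them. *)
Require Import Defs.
From Stdlib Require Import Relation_Operators.
From mathcomp Require Import all_boot all_order all_fingroup all_algebra.
From mathcomp Require Import zify.

Set Implicit Arguments.
Unset Strict Implicit.
Unset Printing Implicit Defensive.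

(** * Lattice-path sums and the reflection of paths *)

(* s is read as a lattice path starting at (x, y), with steps (1, 0) for each 1
   and (0, 1) for each 2. *)
Fixpoint step_sum (c : nat) (W : nat -> nat -> nat) (x y : nat) (s : seq nat) :
    nat :=
  if s is d :: s' then
    (d == c) * W x y + step_sum c W (x + (d == 1)) (y + (d == 2)) s'
  else 0.

Lemma step_sum_cat c W x y s1 s2 :
  step_sum c W x y (s1 ++ s2) = step_sum c W x y s1
    + step_sum c W (x + count_mem 1 s1) (y + count_mem 2 s1) s2.
Proof.
elim: s1 x y => [|d s1 IH] x y /=; first by rewrite !addn0.
by rewrite IH -!addnA.
Qed.

Lemma step_sumE c W x y s :
  step_sum c W x y s = \sum_(q < size s)
    (nth 0 s q == c)
    * W (x + count_mem 1 (take q s)) (y + count_mem 2 (take q s)).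
Proof.
elim: s x y => [|d s IH] x y /=; first by rewrite big_ord0.
rewrite big_ord_recl /= !addn0 IH; congr (_ + _).
by apply: eq_bigr => q _ /=; rewrite !addnA.
Qed.

(** Telescoping: a 1-step raises [P] by [W1] and a 2-step lowers it by [W2]. The additive form
    avoids truncated subtraction. *)
Lemma step_sum_potential W1 W2 P x y s :
  all (mem [:: 1; 2]) s ->
  (forall u v, u < x + count_mem 1 s -> P u.+1 v = P u v + W1 u v) ->
  (forall u v, v < y + count_mem 2 s -> P u v = P u v.+1 + W2 u v) ->
  step_sum 2 W2 x y s + P (x + count_mem 1 s) (y + count_mem 2 s)
  = step_sum 1 W1 x y s + P x y.
Proof.
elim: s x y => [|d s IH] x y /=; first by rewrite !addn0.
rewrite !inE => /andP[dE s12] H1 H2.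
have {IH} := IH (x + (d == 1)) (y + (d == 2)) s12.
rewrite -!addnA => /(_ H1 H2).
case/orP: dE H1 H2 => /eqP-> /= H1 H2; rewrite !addn0 !addn1 => IH.
  by rewrite IH H1; lia.
by rewrite (H2 x y); lia.
Qed.

Lemma count_reverse_swap s :
  (count_mem 1 (reverse_swap s) = count_mem 2 s)
  * (count_mem 2 (reverse_swap s) = count_mem 1 s).
Proof.
by split; rewrite /reverse_swap count_map count_rev; apply: eq_count => x;
  rewrite /= /swap12; case: (x =P 1) => ?; case: (x =P 2) => ? //=; lia.
Qed.

Lemma all_reverse_swap s :
  all (mem [:: 1; 2]) s -> all (mem [:: 1; 2]) (reverse_swap s).
Proof.
rewrite /reverse_swap all_map all_rev; apply: sub_all => x.
by rewrite /= /swap12 !inE => /orP[]/eqP->.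
Qed.

(** The reflection (u, v) -> (n-v, n-u) turns a 2-step out of (u, v) into a 1-step out of (n-v-1,
    n-u). It reverses direction, so the new path starts at the image of the old endpoint. *)
Lemma step_sum_reverse_swap n W1 W2 x y s :
  all (mem [:: 1; 2]) s -> x + count_mem 1 s <= n -> y + count_mem 2 s <= n ->
  (forall u v, u <= n -> v < n -> W2 u v = W1 (n - v.+1) (n - u)) ->
  step_sum 2 W2 x y s
  = step_sum 1 W1 (n - (y + count_mem 2 s)) (n - (x + count_mem 1 s))
      (reverse_swap s).
Proof.
move=> + + + HW; elim: s x y => [|d s IH] x y //=.
rewrite !inE => /andP[dE s12] xn yn.
rewrite /reverse_swap rev_cons map_rcons -/(reverse_swap s) -cats1.
rewrite step_sum_cat !count_reverse_swap IH -?addnA //.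
rewrite addnC; congr (_ + _) => /=.
rewrite addn0.
case/orP: dE xn yn => /eqP-> /= xn yn; rewrite !(mul0n, mul1n) //.
by rewrite HW; [congr (W1 _ _)|..]; lia.
Qed.

(** * The potential, its difference weights and their symmetry *)

(** This is P; [one_weight] is G and [two_weight] is F. For a deck with x 1's and y 2's above a cut
    at x + y, P counts the pairs (w, t) in which the 1's, and no 2's, have keys below (t, x + y). G
    and F require in addition that the card at the cut, a 1 or a 2 respectively, has digit t in
    place of its own bound. *)
Definition cut_potential n a x y :=
  \sum_(t < a) t.+1 ^ x * t ^ (n - x) * (a - t.+1) ^ y * (a - t) ^ (n - y).

Definition one_weight n a x y :=
  \sum_(t < a) t.+1 ^ x * t ^ (n - x.+1) * (a - t.+1) ^ y * (a - t) ^ (n - y).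

Definition two_weight n a x y :=
  \sum_(t < a) t.+1 ^ x * t ^ (n - x) * (a - t.+1) ^ y * (a - t) ^ (n - y.+1).

Lemma cut_potential_one n a x y : x < n ->
  cut_potential n a x.+1 y = cut_potential n a x y + one_weight n a x y.
Proof.
move=> xn; rewrite /cut_potential /one_weight -big_split /=.
apply: eq_bigr => t _; rewrite -(subnSK xn) !expnS.
by do 4! [move: (_ ^ _) => ?]; lia.
Qed.

Lemma cut_potential_two n a x y : y < n ->
  cut_potential n a x y = cut_potential n a x y.+1 + two_weight n a x y.
Proof.
move=> yn; rewrite /cut_potential /two_weight -big_split /=.
(* Writing a - t as (a - t - 1) + 1 isolates the difference. *)
apply: eq_bigr => t _; rewrite -(subnSK yn) -(subnSK (ltn_ord t)) !expnS.
by do 4! [move: (_ ^ _) => ?]; move: (a - _) => ?; lia.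
Qed.

(** Replacing t by a - 1 - t exchanges t + 1 with a - t, and t with a - t - 1. *)
Lemma cut_potential_sym n a x y : x <= n -> y <= n ->
  cut_potential n a x y = cut_potential n a (n - y) (n - x).
Proof.
move=> xn yn; rewrite /cut_potential (reindex_inj rev_ord_inj) /=.
apply: eq_bigr => t _; have ta := ltn_ord t.
rewrite subnSK // (subKn ta) (subKn (ltnW ta)) (subKn xn) (subKn yn).
by do 4! [move: (_ ^ _) => ?]; lia.
Qed.

Lemma two_weight_sym n a x y : x <= n -> y < n ->
  two_weight n a x y = one_weight n a (n - y.+1) (n - x).
Proof.
move=> xn yn; rewrite /two_weight /one_weight (reindex_inj rev_ord_inj) /=.
apply: eq_bigr => t _; have ta := ltn_ord t.
rewrite !subnSK // (subKn ta) (subKn (ltnW ta)) (subKn xn) (subKn (ltnW yn)).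
by do 4! [move: (_ ^ _) => ?]; lia.
Qed.

Lemma step_sum_flip n a al be ga :
  all (mem [:: 1; 2]) be -> size al = size ga ->
  count_mem 1 be = count_mem 2 be ->
  count_mem 1 (al ++ be ++ ga) = n -> count_mem 2 (al ++ be ++ ga) = n ->
  size (al ++ be ++ ga) = n + n ->
  step_sum 2 (two_weight n a) 0 0 (al ++ be ++ ga)
  = step_sum 2 (two_weight n a) 0 0 (al ++ reverse_swap be ++ ga).
Proof.
move=> be12 szE bal c1 c2 sz.
(* A balanced [be] and its flip have the same displacement, so the sums over [ga] agree. *)
rewrite !step_sum_cat !add0n !count_reverse_swap bal.
congr (_ + (_ + _)).
have szbe : size be = count_mem 1 be + count_mem 2 be.
  elim: (be) be12 => //= d s IH; rewrite !inE => /andP[dE /IH->].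
  by case/orP: dE => /eqP->/=; lia.
have szle s : count_mem 1 s + count_mem 2 s <= size s.
  elim: s => //= d s IH; by case: (d =P 1) => [->|]; case: (d =P 2) => /=; lia.
have := szle al; have := szle ga.
move: c1 c2 sz; rewrite !count_cat !size_cat => c1 c2 sz sal sga.
set x := count_mem 1 al in c1 sal *; set y := count_mem 2 al in c2 sal *.
(* The counts exhaust all 2n cards, so equal sizes of [al] and [ga] put [be] in the centre: the
   reflection exchanges its two endpoints. *)
have mid : x + y + count_mem 1 be = n by lia.
rewrite (@step_sum_reverse_swap n (one_weight n a)) //; try lia; last first.
  by move=> u v; apply: two_weight_sym.
have -> : n - (y + count_mem 2 be) = x by lia.
have -> : n - (x + count_mem 1 be) = y by lia.
have := @step_sum_potential (one_weight n a) (two_weight n a)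
  (cut_potential n a) x y (reverse_swap be) (all_reverse_swap be12).
rewrite !count_reverse_swap.
have Pe : cut_potential n a (x + count_mem 2 be) (y + count_mem 1 be)
        = cut_potential n a x y.
  by rewrite (cut_potential_sym a (x := x)); [congr cut_potential|..]; lia.
rewrite Pe => /(_ _ _)/addIn H; apply/esym/H.
- by move=> u v ?; apply: cut_potential_one; lia.
- by move=> u v ?; apply: cut_potential_two; lia.
Qed.

(** * Words whose shuffle produces a given deck *)

Section Counting.
Variables (a N : nat).
Implicit Types (w : {ffun 'I_N -> 'I_a}) (D : N.-tuple nat) (i j q : 'I_N).

(* Orders positions lexicographically by (w i, i), since i < N. *)
Definition lex_key w i := w i * N + i.

Lemma lex_keyE w i j :
  (lex_key w i < lex_key w j) = (w i < w j) || (w i == w j) && (i < j).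
Proof.
rewrite /lex_key -val_eqE /=; have := ltn_ord i; have := ltn_ord j.
move: (nat_of_ord (w i)) (nat_of_ord (w j)) => u v jN iN.
case: (ltngtP u v) => [uv|vu|->] /=; last by rewrite ltn_add2l.
  by have := leq_mul2r N u.+1 v; rewrite uv orbT mulSn; lia.
by have := leq_mul2r N v.+1 u; rewrite vu orbT mulSn; lia.
Qed.

Lemma lex_key_inj w : injective (lex_key w).
Proof.
move=> i j E; have := lex_keyE w i j; have := lex_keyE w j i.
rewrite E ltnn => h1 h2.
by apply: val_inj; move: h1 h2; rewrite -!val_eqE /=; lia.
Qed.

Definition ones_first D w :=
  [forall i, forall j, (tnth D i == 1) && (tnth D j != 1)
     ==> (lex_key w i < lex_key w j)].

(** [stably_sorts] compares neighbours only; induction on the larger index reaches all pairs, and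
    trichotomy gives the converse. *)
Lemma stably_sorts_mono w (p : 'S_N) : stably_sorts w p ->
  {mono p : j k / j < k >-> lex_key w j < lex_key w k}.
Proof.
move=> /forallP h.
have step (j k : 'I_N) : k = j.+1 :> nat -> lex_key w (p j) < lex_key w (p k).
  move=> kE; have /forallP/(_ k)/implyP := h j.
  rewrite kE eqxx => /(_ isT); rewrite lex_keyE -!val_eqE /=; lia.
have inc (j k : 'I_N) : j < k -> lex_key w (p j) < lex_key w (p k).
  move: k => [k kN] /=; elim: k kN => // k IH kN jk.
  apply: leq_ltn_trans (step (Ordinal (ltnW kN)) _ _) => //.
  case: (ltnP j k) => [jk'|kj]; first exact: ltnW (IH _ jk').
  by rewrite (_ : Ordinal _ = j) //; apply: val_inj => /=; lia.
move=> j k; case: (ltngtP j k) => [/inc //|/inc ?|/val_inj ->].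
  by apply/negbTE; rewrite -leqNgt ltnW.
by rewrite ltnn.
Qed.

End Counting.

(** Reading D in the order of p must give back the sorted deck. For a rearrangement of that deck
    this amounts to being sorted, that is, to no 2 preceding a 1 in key order. *)
Lemma apply_shuffle_sorted a n (w : {ffun 'I_(n + n) -> 'I_a}) p
    (D : (n + n).-tuple nat) :
  perm_eq D (sorted_deck n) -> stably_sorts w p ->
  (apply_shuffle p (sorted_deck n) == D) = ones_first D w.
Proof.
move=> Dp wp.
pose E := [tuple tnth D (p k) | k < n + n].
have sortedS : sorted leq (sorted_deck n).
  apply/(sortedP 0) => k; rewrite size_tuple => kn.
  by rewrite /= !nth_cat !nth_nseq size_nseq; do !case: ifP; lia.
have D12 i : (tnth D i == 1) || (tnth D i == 2).
  have : tnth D i \in sorted_deck n by rewrite -(perm_mem Dp) mem_tnth.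
  by rewrite mem_cat !mem_nseq; lia.
have EE : (apply_shuffle p (sorted_deck n) == D) = (E == sorted_deck n).
  apply/eqP/eqP => [DS|ES]; apply: eq_from_tnth => i; rewrite tnth_mktuple.
    by rewrite -DS tnth_mktuple permK.
  by rewrite -ES tnth_mktuple permKV.
have ED : perm_eq E D.
  by apply/tuple_permP; exists p; rewrite /E.
have {EE} -> : (apply_shuffle p (sorted_deck n) == D) = sorted leq E.
  rewrite EE; apply/eqP/idP => [->//|Es]; apply: val_inj.
  apply: (sorted_eq leq_trans anti_leq Es sortedS).
  exact: perm_trans ED Dp.
have nthE (k : 'I_(n + n)) : nth 0 E k = tnth D (p k).
  by rewrite -tnth_nth tnth_mktuple.
apply/idP/forallP => [Es i|V].
  apply/forallP => j; apply/implyP => /andP[/eqP Di Dj].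
  rewrite -(permKV p i) -(permKV p j) (stably_sorts_mono wp) ltnNge.
  apply/negP => ji; have := sorted_leq_nth leq_trans leqnn 0 Es.
  move/(_ (p^-1 j)%g (p^-1 i)%g); rewrite !inE size_tuple !ltn_ord.
  move/(_ isT isT ji).
  by rewrite !nthE !permKV Di; have := D12 j; lia.
apply/(sortedP 0) => k; rewrite size_tuple => kN.
rewrite (nthE (Ordinal kN)) (nthE (Ordinal (ltnW kN))).
set k1 := Ordinal kN; set k0 := Ordinal (ltnW kN).
have /forallP/(_ (p k0))/implyP := V (p k1).
rewrite (stably_sorts_mono wp) /= ltnNge leqnSn.
by have := D12 (p k0); have := D12 (p k1); lia.
Qed.

(** After exchanging the sums, each word contributes only through its unique stable sorting
    permutation. *)
Lemma transition_probE a n (D : (n + n).-tuple nat) :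
  perm_eq D (sorted_deck n) ->
  transition_prob a (sorted_deck n) D
  = (#|[set w : {ffun 'I_(n + n) -> 'I_a} | ones_first D w]|%:R
      / (a ^ (n + n))%:R)%R.
Proof.
move=> Dp; rewrite /transition_prob /ashuffle_prob -GRing.mulr_suml.
congr (_ / _)%R; rewrite -GRing.natr_sum; congr (_%:R)%R.
under eq_bigr do rewrite -sum1dep_card.
rewrite -sum1dep_card (exchange_big_dep predT) //= [RHS]big_mkcond /=.
apply: eq_bigr => w _; have [p [wp up]] := stably_sorts_unique w.
rewrite (eq_bigl (fun p' => (p' == p) && ones_first D w)) => [|p'].
  by rewrite big_mkcondr big_pred1_eq.
case: (p' =P p) => [->|np] /=.
  by rewrite wp andbT (apply_shuffle_sorted Dp wp).
by rewrite andbC; case: (boolP (stably_sorts w p')) => // /up /esym.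
Qed.

(** * Counting the words by the first 2 in key order *)

Lemma prodn_count n1 n2 (s : seq nat) :
  all (mem [:: 1; 2]) s ->
  \prod_(d <- s) (if d == 1 then n1 else n2)
  = n1 ^ count_mem 1 s * n2 ^ count_mem 2 s.
Proof.
elim: s => [|d s IH]; first by rewrite big_nil.
rewrite big_cons /= !inE => /andP[/orP[]/eqP-> /IH->] /=.
  by rewrite expnS mulnA.
by rewrite expnS mulnCA.
Qed.

Lemma card_ord_lt a m : m <= a -> #|[pred u : 'I_a | u < m]| = m.
Proof.
move=> ma; rewrite -sum1_card -[RHS]card_ord -sum1_card.
by rewrite [RHS](big_ord_widen _ (fun=> 1) ma).
Qed.

Lemma card_ord_ge a m : m <= a -> #|[pred u : 'I_a | m <= u]| = a - m.
Proof.
move=> ma; rewrite -[a in RHS]card_ord -(cardC [pred u : 'I_a | u < m]).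
rewrite card_ord_lt // addKn; apply: eq_card => u.
by rewrite !inE /= -leqNgt.
Qed.

Section CountingOnesFirst.
Variables (a N : nat).
Implicit Types (w : {ffun 'I_N -> 'I_a}) (D : N.-tuple nat) (i j q : 'I_N).

Definition first_other D q w :=
  [forall i, if tnth D i == 1 then lex_key w i < lex_key w q
             else lex_key w q <= lex_key w i].

(** Any q with [first_other] separates the 1's from the rest. Conversely q must minimise the key
    among the other cards, and keys are injective. *)
Lemma ones_first_min D w : has (predC1 1) D ->
  (ones_first D w : nat) = \sum_(q | tnth D q != 1) first_other D q w.
Proof.
case/(has_tnthP) => q0 /= q0P.
case V: (ones_first D w); last first.
  rewrite big1 // => q qD; apply/eqP; rewrite eqb0; apply: contraFN V.
  move=> /forallP M; apply/forallP => i; apply/forallP => j.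
  apply/implyP => /andP[Di Dj]; have := M i; have := M j.
  by rewrite Di (negPf Dj) => h1 h2; apply: leq_trans h2 h1.
case: (@arg_minnP _ q0 (fun i => tnth D i != 1) (lex_key w) q0P) => q qD qmin.
rewrite (bigD1 q) //= big1 => [|q' /andP[q'D q'q]].
  rewrite (_ : first_other _ _ _) //; apply/forallP => i.
  case: ifPn => [Di|/qmin//].
  by have /forallP/(_ i)/forallP/(_ q)/implyP := V; rewrite Di; apply.
apply/eqP; rewrite eqb0; apply: contra q'q => /forallP/(_ q).
rewrite (negPf qD) => le; rewrite eq_sym; apply/eqP/(@lex_key_inj _ _ w).
by apply/eqP; rewrite eqn_leq qmin.
Qed.

Lemma card_first_other D q (t : 'I_a) :
  all (mem [:: 1; 2]) D -> tnth D q != 1 ->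
  #|[set w : {ffun 'I_N -> 'I_a} | first_other D q w && (w q == t)]|
  = t.+1 ^ count_mem 1 (take q D) * (a - t.+1) ^ count_mem 2 (take q D)
    * (t ^ count_mem 1 (drop q.+1 D) * (a - t) ^ count_mem 2 (drop q.+1 D)).
Proof.
move=> D12 Dq.
(* Once w q = t, the digits are constrained independently; ties are broken by position, so strict
   and weak bounds trade places at q. *)
pose A i : pred 'I_a := fun u =>
  if i < q then (if tnth D i == 1 then u <= t else t < u)
  else if i == q then u == t
  else if tnth D i == 1 then u < t else t <= u.
have -> : #|[set w : {ffun 'I_N -> 'I_a} | first_other D q w && (w q == t)]|
        = #|family A|.
  apply: eq_card => w; rewrite inE; apply/andP/familyP.
    case=> /forallP M /eqP wq i; have := M i.
    rewrite unfold_in [lex_key w q <= _]leqNgt !lex_keyE wq -!val_eqE /=.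
    case: (ltngtP i q) => [||/val_inj->]; rewrite ?wq; case: ifP; lia.
  move=> M; have wq : w q = t.
    by have := M q; rewrite unfold_in ltnn eqxx => /eqP.
  split; last by rewrite wq.
  apply/forallP => i; have := M i.
  rewrite unfold_in [lex_key w q <= _]leqNgt !lex_keyE wq -!val_eqE /=.
  case: (ltngtP i q) => [||/val_inj->] /=.
  - by case: ifP; lia.
  - by case: ifP; lia.
  - by rewrite (negbTE Dq) wq; lia.
rewrite card_family foldrE big_map big_enum /=.
(* [g] gives the size of [A] at a natural-number index, so that the product can be split at q. *)
pose g k d := if k < q then (if d == 1 then t.+1 else a - t.+1)
  else if k == q then 1 else if d == 1 then t : nat else a - t.
transitivity (\prod_(0 <= k < N) g k (nth 0 D k)).
  rewrite big_mkord; apply: eq_bigr => i _; rewrite /g /A -tnth_nth -val_eqE /=.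
  have ta := ltn_ord t.
  case: ltngtP => _; last by rewrite card1.
    case: eqP => _; first exact: (card_ord_lt ta).
    exact: (card_ord_ge ta).
  case: eqP => _; first exact: (card_ord_lt (ltnW ta)).
  exact: (card_ord_ge (ltnW ta)).
rewrite (big_cat_nat _ (n := q)) //=; last exact: ltnW.
rewrite (@big_ltn _ _ _ q) // {2}/g ltnn eqxx mul1n.
rewrite -!prodn_count; first last.
- by apply/allP => d /mem_take/(allP D12).
- by apply/allP => d /mem_drop/(allP D12).
congr (_ * _).
  rewrite [RHS](big_nth 0) size_takel ?size_tuple; last exact: ltnW.
  by apply: eq_big_nat => k /andP[_ kq]; rewrite nth_take // /g kq.
rewrite [RHS](big_nth 0) size_drop size_tuple -{1}[q.+1]add0n big_addn.
apply: eq_big_nat => k _; rewrite nth_drop /g addnC.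
by case: ltngtP => //; lia.
Qed.

Lemma card_ones_first n D :
  all (mem [:: 1; 2]) D -> has (predC1 1) D ->
  count_mem 1 D = n -> count_mem 2 D = n ->
  #|[set w : {ffun 'I_N -> 'I_a} | ones_first D w]|
  = step_sum 2 (two_weight n a) 0 0 D.
Proof.
move=> D12 D2 c1 c2; rewrite step_sumE size_tuple.
rewrite -sum1dep_card big_mkcond /=.
under eq_bigr => w _ do
  rewrite -[if _ then _ else _]/(nat_of_bool _) ones_first_min //.
rewrite exchange_big big_mkcond /=; apply: eq_bigr => q _.
have D12q : tnth D q \in [:: 1; 2] by apply: (allP D12); exact: mem_tnth.
rewrite -tnth_nth; case: (tnth D q =P 1) D12q => [->//|/eqP nq] /=.
rewrite !inE (negPf nq) /= => q2; rewrite q2 mul1n.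
have -> : \sum_w first_other D q w
        = #|[set w : {ffun 'I_N -> 'I_a} | first_other D q w]|.
  by rewrite -sum1dep_card [RHS]big_mkcond.
rewrite -sum1dep_card.
(* The digit t of the first 2 is the summation index of [two_weight]. *)
rewrite (partition_big (fun w : {ffun 'I_N -> 'I_a} => w q) predT) //=.
apply: eq_bigr => t _; rewrite sum1dep_card card_first_other //.
have dE : D = take q D ++ tnth D q :: drop q.+1 D :> seq nat.
  by rewrite (tnth_nth 0) -drop_nth ?cat_take_drop ?size_tuple.
move: c1 c2; rewrite dE !count_cat /= (negPf nq) q2 => c1 c2.
rewrite -dE !add0n.
have -> : n - count_mem 1 (take q D) = count_mem 1 (drop q.+1 D).
  by rewrite -c1 add0n addKn.
have -> : n - (count_mem 2 (take q D)).+1 = count_mem 2 (drop q.+1 D).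
  by rewrite -c2 add1n -addSnnS addKn.
by do 4! [move: (_ ^ _) => ?]; lia.
Qed.

End CountingOnesFirst.

Theorem theorem3p1 (n : nat) (hn : (1 <= n)%N) (D1 D2 : deck12 n)
    (hR : R_related D1 D2) (a : nat) (ha : (1 <= a)%N) :
  transition_prob a (sorted_deck n) (sval D1)
  = transition_prob a (sorted_deck n) (sval D2).
Proof.
have deckP (D : deck12 n) : [/\ all (mem [:: 1; 2]) (sval D),
    has (predC1 1) (sval D), count_mem 1 (sval D) = n
    & count_mem 2 (sval D) = n].
  case: D => D /= Dp; have/seq.permP Dc := Dp; split.
  - by rewrite (perm_all _ Dp) all_cat !all_nseq !orbT.
  (* Here n >= 1 guarantees that a first 2 exists. *)
  - by rewrite (perm_has _ Dp) has_cat !has_nseq hn orbT.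
  - by rewrite Dc count_cat !count_nseq /=; lia.
  - by rewrite Dc count_cat !count_nseq /=; lia.
elim: hR => {D1 D2} [D1 D2|//|D1 D2 D3 _ -> _ -> //].
case=> al [be [ga [E1 E2 szE bal]]].
have [all1 has1 c11 c12] := deckP D1; have [all2 has2 c21 c22] := deckP D2.
rewrite (transition_probE a (svalP D1)) (transition_probE a (svalP D2)).
rewrite (card_ones_first a all1 has1 c11 c12).
rewrite (card_ones_first a all2 has2 c21 c22).
have sz1 : size (sval D1) = n + n by rewrite size_tuple.
rewrite E1 in all1 c11 c12 sz1 *; rewrite E2 (step_sum_flip a _ szE bal) //.
by move: all1; rewrite !all_cat => /and3P[].
Qed.
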